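(* Let $G$ be a countably infinite group and let $\varepsilon,\delta>0$. Suppose a sequence $F=(F_N)_{N\in\mathbb{N}}$ of finite nonempty subsets of $G$ has the property that, for all measure preserving systems $(X,\mathcal{B},\mu,(T_g)_{g\in G})$ and all $Y\in\mathcal{B}$ satisfying $\mu(Y)\geq\varepsilon$, we have $$\limsup_{N\to\infty}\frac{1}{|F_N|}\sum_{g\in F_N}\mu(Y\cap T_{g}Y)\geq\delta.$$ Then for all measure preserving systems $(X,\mathcal{B},\mu,(T_{(g,h)})_{(g,h)\in G\times G})$ and all $Y\in\mathcal{B}$ with $\mu(Y)\geq\varepsilon$, there exists $B\subseteq G$ such that $\overline{d}_F(B)\geq\delta$ and $$B\times B\subseteq\left\{(g,h)\in G\times G:\mu\left(Y\cap T_{(g,h)}Y\right)>0\right\}.$$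
   Context: For a group $K$, a measure preserving system $(X,\mathcal{B},\mu,(T_k)_{k\in K})$ consists of a probability space $(X,\mathcal{B},\mu)$ and a left action $(T_k)_{k\in K}$ of $K$ on $X$ by measure-preserving maps, so that $T_{kl}=T_k\circ T_l$. For a sequence $F=(F_N)$ of finite nonempty subsets of $G$ and $E\subseteq G$, the upper density of $E$ along $F$ is $\overline{d}_F(E)=\limsup_{N\to\infty}\frac{|E\cap F_N|}{|F_N|}$. *)

(* Defs.v *)
From mathcomp Require Export all_boot all_order all_algebra finmap.
From mathcomp Require Export all_classical all_reals all_analysis.

Set Implicit Arguments.
Unset Strict Implicit.
Unset Printing Implicit Defensive.

Import Order.TTheory GRing.Theory Num.Theory.

Local Open Scope classical_set_scope.
Local Open Scope ring_scope.
Local Open Scope ereal_scope.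

Definition left_action (K : groupType) (X : Type) (T : K -> X -> X) : Prop :=
  T 1%g = id /\ forall k l : K, T (k * l)%g = T k \o T l.

Definition measure_preserving (R : realType) (d : measure_display)
    (X : measurableType d) (mu : probability X R) (f : X -> X) : Prop :=
  measurable_fun setT f /\
  forall A : set X, measurable A -> mu (f @^-1` A) = mu A.

Definition measure_preserving_system (R : realType) (K : groupType)
    (d : measure_display) (X : measurableType d) (mu : probability X R)
    (T : K -> X -> X) : Prop :=
  left_action T /\ forall k : K, measure_preserving mu (T k).

Definition upper_density (R : realType) (G : groupType) (F : nat -> {fset G})
    (E : set G) : \bar R :=
  limn_esup (fun N =>
    ((#|` [fset g in F N | g \in E]%fset|)%:R / (#|` F N|)%:R)%:E).

(* Main.v *)
Require Import Defs.
From mathcomp Require Import measurable_realfun.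

(** For [g] in [G] let [L g] and [H g] be the images of [Y] under
    [T (g^-1, 1)] and [T (1, g)].  Since [T] preserves [mu],

      mu (L g /\ H h) = mu (Y /\ T (g, h) Y)  for all g and h,

    which separates the two coordinates.  To a point [x] attach the set [B] of
    all [g] such that [x] lies in both [L g] and [H g].  If [g] and [h] belong
    to [B], then [x] lies in [L g /\ H h]; when [x] is outside the union of
    those countably many intersections that are null, this forces
    [mu (Y /\ T (g, h) Y) > 0].  So every such [x] gives a set [B] with the
    required product property, and only the density of [B] is at stake.

    The proportion of [F N] contained in [B] is the average over [g] in [F N] of
    the indicators of [L g /\ H g] at [x].  Its integral is the average of
    [mu (Y /\ T (g, g) Y)], and the limsup of these averages is at least [delta]
    by the recurrence hypothesis for the diagonal action [g |-> T (g, g)].  The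
    reverse Fatou inequality ([reverse_fatou]) then bounds the integral of the
    upper density from below by [delta], so the upper density is at least
    [delta] at some [x] off the null set ([limsup_integral_attained],
    [upper_density_attained]). *)

Import Order.TTheory GRing.Theory Num.Theory.

Local Open Scope classical_set_scope.
Local Open Scope ring_scope.
Local Open Scope ereal_scope.

Lemma negligible_countable_bigcup (R : realType) (d : measure_display)
    (X : measurableType d) (mu : {measure set X -> \bar R}) (I : Type)
    (N : I -> set X) :
  countable [set: I] -> (forall i, mu.-negligible (N i)) ->
  mu.-negligible (\bigcup_i N i).
Proof.
elim/Ppointed: I => I in N *.
  by move=> *; rewrite empty_eq0 bigcup0//; exact: negligible_set0.
move=> /countable_bijP[B] /ppcard_eqP[f] N0.
rewrite (reindex_bigcup f^-1%FUN setT)//=; first exact: negligible_bigcup.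
exact: (@subl_surj _ _ B).
Qed.

Lemma limn_esup_bounded (R : realType) (M : R) (u : nat -> \bar R) :
  (forall n, 0 <= u n <= M%:E) -> 0 <= limn_esup u <= M%:E.
Proof.
move=> uM; apply/andP; split.
  apply: limf_esup_ge0; first exact: filter_not_empty.
  by move=> n; case/andP: (uM n).
rewrite limn_esup_lim; apply: lime_le; first exact: is_cvg_esups.
apply: nearW => n; apply: ge_ereal_sup => _ [m /= _ <-].
by case/andP: (uM m).
Qed.

Lemma bounded_integrable (R : realType) (d : measure_display)
    (X : measurableType d) (mu : {finite_measure set X -> \bar R}) (D : set X)
    (M : R) (f : X -> \bar R) :
  measurable D -> measurable_fun D f -> (forall x, 0 <= f x <= M%:E) ->
  mu.-integrable D f.
Proof.
move=> mD mf fM.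
apply: (le_integrable mD mf _ (finite_measure_integrable_cst mu M mD)).
move=> x _ /=.
have /andP[f0 fMx] := fM x.
by rewrite gee0_abs// (le_trans fMx)// lee_fin ler_norm.
Qed.

(** Fatou's lemma for the nonnegative functions [M - f n].  The bound [M] on a
    set of finite measure makes all the subtractions finite. *)
Lemma reverse_fatou (R : realType) (d : measure_display)
    (X : measurableType d) (mu : {finite_measure set X -> \bar R}) (D : set X)
    (M : R) (f : nat -> X -> \bar R) :
  measurable D -> (forall n, measurable_fun D (f n)) ->
  (forall n x, 0 <= f n x <= M%:E) ->
  limn_esup (fun n => \int[mu]_(x in D) f n x) <=
    \int[mu]_(x in D) limn_esup (f ^~ x).
Proof.
move=> mD mf fM.
have int_compl g : measurable_fun D g -> (forall x, 0 <= g x <= M%:E) ->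
    \int[mu]_(x in D) (M%:E - g x) = M%:E * mu D - \int[mu]_(x in D) g x.
  move=> mg gM; rewrite -integral_cst// -integralB//.
    exact: finite_measure_integrable_cst.
  exact: bounded_integrable gM.
have mlim : measurable_fun D (fun x => limn_esup (f ^~ x)).
  exact: measurable_fun_limn_esup.
have limM x : 0 <= limn_esup (f ^~ x) <= M%:E by exact: limn_esup_bounded.
have compl_shift (l : \bar R) (u : nat -> \bar R) : l \is a fin_num ->
    limn_einf (fun n => l - u n) = l - limn_esup u.
  by move=> lfin; rewrite limn_einf_shift// -limn_einfN.
have Mfin : M%:E * mu D \is a fin_num.
  by rewrite fin_numM// fin_num_measure.
have := @fatou _ _ _ mu D mD (fun n x => M%:E - f n x) _ _.
under eq_integral do rewrite compl_shift//.
rewrite (int_compl _ mlim limM).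
under [X in _ <= limn_einf X]eq_fun => n
  do rewrite (int_compl _ (mf n) (fM n))//.
rewrite compl_shift//.
rewrite leeD2lE// leeN2; apply.
  by move=> n; apply: emeasurable_funB.
by move=> n x _; have /andP[_ fnM] := fM n x; rewrite sube_ge0// orbT.
Qed.

(** A function that is below [c] off a null set has integral below [c] for a
    probability measure, so the reverse Fatou inequality produces a good point.
    That point can be kept out of any prescribed null set, which is what allows
    countably many almost sure conditions to be imposed on it. *)
Lemma limsup_integral_attained (R : realType) (d : measure_display)
    (X : measurableType d) (mu : probability X R) (N : set X) (c M : R)
    (f : nat -> X -> \bar R) :
  mu.-negligible N -> (forall n, measurable_fun setT (f n)) ->
  (forall n x, 0 <= f n x <= M%:E) ->
  c%:E <= limn_esup (fun n => \int[mu]_x f n x) ->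
  exists x, ~ N x /\ c%:E <= limn_esup (f ^~ x).
Proof.
move=> [N' [mN' N'0 NN']] mf fM le_c; apply: contrapT => no_x.
(* If no point works, the limsup is below [c] on all of [D], which has full
   measure, and [c - limsup] is a positive function with integral at most 0. *)
pose D := ~` N'; have mD : measurable D by exact: measurableC.
have muD : mu D = 1 by rewrite probability_setC// N'0 sube0.
pose h x := limn_esup (f ^~ x).
have mh : measurable_fun D h.
  apply: measurable_fun_limn_esup => n.
  exact: measurable_funS (mf n).
have hM x : 0 <= h x <= M%:E by exact: limn_esup_bounded.
have lt_h x : D x -> h x < c%:E.
  move=> Dx; rewrite ltNge; apply/negP => cx; apply: no_x; exists x.
  by split=> // /NN'.
have le_int : c%:E <= \int[mu]_(x in D) h x.
  apply: (le_trans le_c).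
  have -> : (fun n => \int[mu]_x f n x) = fun n => \int[mu]_(x in D) f n x.
    apply/funext => n; rewrite (@ge0_negligible_integral _ _ _ _ setT N')//.
      by rewrite setTD.
    by move=> x _; case/andP: (fM n x).
  by apply: reverse_fatou => // n; exact: measurable_funS (mf n).
have mch : measurable_fun D (fun x => c%:E - h x) by exact: emeasurable_funB.
have ch0 x : D x -> 0 <= c%:E - h x.
  by move=> /lt_h/ltW; rewrite sube_ge0// orbT.
have int0 : \int[mu]_(x in D) `|c%:E - h x| = 0.
  transitivity (\int[mu]_(x in D) (c%:E - h x)).
    by apply: eq_integral => x /[!inE] Dx; rewrite gee0_abs// ch0.
  apply/eqP; rewrite eq_le integral_ge0// andbT integralB//.
  - have -> : \int[mu]_(x in D) c%:E = c%:E.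
      by rewrite integral_cst// -[RHS]mule1 -muD.
    by rewrite sube_le0// le_int.
  - exact: finite_measure_integrable_cst.
  - exact: (@bounded_integrable _ _ _ mu D M).
have [Z [mZ Z0 DZ]] := (ae_eq_integral_abs mu mD mch).1 int0.
have : mu D <= mu Z.
  apply: le_measure; rewrite ?inE// => x Dx; apply: DZ => /=.
  move=> /(_ Dx) ch_eq0; have := lt_h x Dx.
  by rewrite -sube_gt0 ch_eq0 ltxx.
by rewrite muD Z0 leNgt lte01.
Qed.

Section Actions.
Context {R : realType} {K : groupType} {d : measure_display}.
Context {X : measurableType d} {mu : probability X R} {T : K -> X -> X}.
Context (mpsT : measure_preserving_system mu T).

Lemma action_cancel k : cancel (T k) (T k^-1%g).
Proof.
by case: mpsT => -[T1 TM] _ x; rewrite -[LHS]/((T _ \o T _) x) -TM mulVg T1.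
Qed.

Lemma action_image k A : T k @` A = T k^-1%g @^-1` A.
Proof.
apply/seteqP; split=> [_ [x Ax <-]|x Ax]; first by rewrite /= action_cancel.
by exists (T k^-1%g x) => //; have := action_cancel k^-1%g x; rewrite invgK.
Qed.

Lemma measurable_action_image k A : measurable A -> measurable (T k @` A).
Proof.
move=> mA; rewrite action_image -[_ @^-1` _]setTI.
by case: mpsT => _ /(_ k^-1%g)[mT _]; exact: mT.
Qed.

(** [T k^-1] preserves [mu] and carries the two images to [A] and to the image
    of [A] under [T (k^-1 * l)]. *)
Lemma measure_action_imageI k l A : measurable A ->
  mu (T k @` A `&` T l @` A) = mu (A `&` T (k^-1 * l)%g @` A).
Proof.
move=> mA; have [[_ TM] /(_ k^-1%g)[_ muT]] := mpsT.
rewrite -[RHS]muT; last exact/measurableI/measurable_action_image.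
rewrite !action_image preimage_setI -comp_preimage -TM.
by rewrite invgM invgK -mulgA mulgV mulg1.
Qed.

End Actions.

(** The recurrence hypothesis speaks of actions of [G] only; it is applied to
    an action of [G * G] through the diagonal. *)
Lemma diagonal_mps (R : realType) (G : groupType) (d : measure_display)
    (X : measurableType d) (mu : probability X R) (T : G * G -> X -> X) :
  measure_preserving_system mu T ->
  measure_preserving_system mu (fun g => T (g, g)).
Proof.
by move=> [[T1 TM] muT]; split=> //; split=> // g h; rewrite -TM.
Qed.

Lemma card_fset_sum_indic (R : realType) (I : choiceType) (F : {fset I})
  (E : set I) :
  (#|` [fset i in F | i \in E]%fset|)%:R = (\sum_(i <- F) \1_E i)%R :> R.
Proof.
rewrite card_fset_sum1 -big_fset_condE natr_sum big_mkcond.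
by apply: eq_bigr => i _; rewrite indicE; case: (i \in E).
Qed.

(** The case of [limsup_integral_attained] where the functions are proportions
    of [F n]: sets that are large on average along [F] have a common point for a
    set of indices of large upper density. *)
Lemma upper_density_attained (R : realType) (G : groupType)
    (F : nat -> {fset G}) (d : measure_display) (X : measurableType d)
    (mu : probability X R) (E : G -> set X) (N : set X) (c : R) :
  (forall g, measurable (E g)) -> mu.-negligible N ->
  c%:E <= limn_esup (fun n =>
    ((#|` F n|)%:R^-1)%:E * \sum_(g <- F n) mu (E g)) ->
  exists x, ~ N x /\ c%:E <= upper_density R F [set g | E g x].
Proof.
move=> mE N0 le_c.
pose f n x : \bar R :=
  ((#|` [fset g in F n | g \in [set g | E g x]]%fset|)%:R /
   (#|` F n|)%:R)%:E.
have fE n x :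
    f n x = (#|` F n|%:R^-1)%:E * \sum_(g <- F n) (\1_(E g) x)%:E.
  rewrite sumEFin -EFinM mulrC /f card_fset_sum_indic.
  by congr ((_ * _)%:E); apply: eq_bigr => g _; rewrite !indicE.
have m1E g : measurable_fun setT (fun x => (\1_(E g) x)%:E : \bar R).
  by apply/measurable_EFinP; exact: measurable_indic.
have mf n : measurable_fun setT (f n).
  rewrite (funext (fE n)); apply: measurable_funeM.
  by apply: emeasurable_sum => g; exact: m1E.
have f01 n x : 0 <= f n x <= 1%:E.
  rewrite !lee_fin divr_ge0//=.
  have [->|F_gt0] := posnP #|` F n|; first by rewrite invr0 mulr0.
  by rewrite ler_pdivrMr ?ltr0n// mul1r ler_nat fsubset_leq_card// fset_sub.
apply: (@limsup_integral_attained _ _ _ mu N c 1 f) => //.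
suff -> : (fun n => \int[mu]_x f n x) =
    fun n => (#|` F n|%:R^-1)%:E * \sum_(g <- F n) mu (E g) by [].
apply/funext => n; under eq_integral do rewrite fE.
rewrite ge0_integralZl_EFin//; last 2 first.
- by move=> x _; apply: sume_ge0 => g _; rewrite lee_fin.
- by apply: emeasurable_sum => g; exact: m1E.
rewrite ge0_integral_sum//; congr (_ * _).
by apply: eq_bigr => g _; rewrite integral_indic// setIT.
Qed.

Theorem theorem1p5 (R : realType) (G : groupType)
    (G_countable : countable [set: G]) (G_infinite : infinite_set [set: G])
    (eps delta : R) (eps_gt0 : (0 < eps)%R) (delta_gt0 : (0 < delta)%R)
    (F : nat -> {fset G}) (F_neq0 : forall N : nat, F N != fset0)
    (F_recurrence :
      forall (d : measure_display) (X : measurableType d)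
        (mu : probability X R) (T : G -> X -> X),
      measure_preserving_system mu T ->
      forall Y : set X, measurable Y -> eps%:E <= mu Y ->
      delta%:E <= limn_esup (fun N =>
        ((#|` F N|)%:R^-1)%:E *
          \sum_(g <- F N) mu (Y `&` (T g @` Y)))) :
  forall (d : measure_display) (X : measurableType d)
    (mu : probability X R) (T : G * G -> X -> X),
  measure_preserving_system mu T ->
  forall Y : set X, measurable Y -> eps%:E <= mu Y ->
  exists B : set G,
    delta%:E <= upper_density R F B /\
    B `*` B `<=` [set gh : G * G | 0 < mu (Y `&` (T gh @` Y))].
Proof.
move=> d X mu T mpsT Y mY leY.
pose L g := T (g^-1%g, 1%g) @` Y; pose H g := T (1%g, g) @` Y.
have muLH g h : mu (L g `&` H h) = mu (Y `&` T (g, h) @` Y).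
  rewrite (measure_action_imageI mpsT)//.
  have -> // : ((g^-1, 1)^-1 * (1, h))%g = (g, h) :> G * G.
  by rewrite -[LHS]/(g^-1^-1 * 1, 1^-1 * h)%g invgK mulg1 invg1 mul1g.
have mLH g h : measurable (L g `&` H h).
  by apply: measurableI; exact: (measurable_action_image mpsT).
pose null := \bigcup_gh
  (if mu (L gh.1 `&` H gh.2) == 0 then L gh.1 `&` H gh.2 else set0).
have null0 : mu.-negligible null.
  apply: negligible_countable_bigcup => [|[g h] /=].
    by rewrite -setXTT; exact: countableX.
  case: ifPn => [/eqP mu0|_]; last exact: negligible_set0.
  exact/negligibleP.
have [x [xnull le_x]] : exists x, ~ null x /\
    delta%:E <= upper_density R F [set g | (L g `&` H g) x].
  apply: (@upper_density_attained _ _ F _ _ mu (fun g => L g `&` H g)) => //.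
  have := F_recurrence _ _ mu _ (diagonal_mps _ _ _ _ _ _ mpsT) _ mY leY.
  congr (_ <= limn_esup _); apply/funext => N; congr (_ * _).
  by apply: eq_bigr => g _; rewrite muLH.
exists [set g | (L g `&` H g) x]; split=> // -[g h] [/= [Lx _] [_ Hx]].
rewrite lt0e measure_ge0 andbT -muLH; apply/negP => mu0; apply: xnull.
by exists (g, h) => //=; rewrite mu0.
Qed.
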